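(* There exists a full and concrete embedding $\mathcal{K}\hookrightarrow\mathcal{S}$ sending each object $(X,\leqslant_X)$ of $\mathcal{K}$ to the unique stream that it underlies. Moreover, the image of this embedding contains every stream $(X,\leqslant)$ such that $X$ is compact Hausdorff, the underlying preordered space $(X,\leqslant_X)$ is locally convex, and the bounded intervals of $(X,\leqslant_X)$ are closed in $X$.
   Context: A preorder is a reflexive and transitive relation; a partial order is an antisymmetric preorder. For a relation $R$ on a set $X$, $\mathrm{graph}(R)=\{(x,y)\in X\times X : x\,R\,y\}$. For a family $\{(A_i,\leqslant_{i})\}_{i}$ of preordered sets, $\bigvee_{i}\leqslant_{i}$ denotes the preorder on $\bigcup_i A_i$ that is the transitive-reflexive closure of the relation with graph $\bigcup_{i}\mathrm{graph}(\leqslant_{i})$. A preordered space is a topological space equipped with a preorder (no compatibility required); it is a partially ordered space if the preorder is a partial order. A bounded interval of $(X,\leqslant_X)$ is a set of the form $\{z\in X : x\leqslant_X z\leqslant_X y\}$ with $x,y\in X$ (possibly empty; the empty set counts as connected). A subset $C\subset X$ is convex in $(X,\leqslant_X)$ if $y\in C$ whenever $x\leqslant_X y\leqslant_X z$ with $x,z\in C$, $y\in X$. A preordered space is locally convex if its topology has a basis of open convex subsets. A monotone map of preordered spaces is a continuous function $f$ with $f(x)\leqslant f(y)$ whenever $x\leqslant y$. A circulation $\leqslant$ on a space $X$ is a function assigning to each open subset $U\subset X$ a preorder $\leqslant_U$ on $U$ such that $\leqslant_{\bigcup\mathcal{O}}=\bigvee_{U\in\mathcal{O}}\leqslant_U$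 for each collection $\mathcal{O}$ of open subsets of $X$. A stream $(X,\leqslant)$ is a space $X$ with a circulation $\leqslant$ on it; the preordered space $(X,\leqslant_X)$ is said to underlie the stream $(X,\leqslant)$. A stream map $f:(X,\leqslant)\to(Y,\leqslant')$ is a continuous function $f:X\to Y$ such that, for all open $U\subset Y$, $f(x)\leqslant'_U f(y)$ whenever $x\leqslant_{f^{-1}U}y$. $\mathcal{S}$ is the category of streams and stream maps. $\mathcal{K}$ is the category of locally convex, compact Hausdorff partially ordered spaces whose bounded intervals are closed and connected, with monotone maps as morphisms. An embedding is a faithful functor injective on objects; concrete means commuting with the forgetful functors to underlying spaces and functions. *)

(* Defs.v *)
From Stdlib Require Import Relation_Definitions Relation_Operators.
From mathcomp Require Import all_boot.
From mathcomp Require Import boolp classical_sets topology.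

Set Implicit Arguments.
Unset Strict Implicit.
Unset Printing Implicit Defensive.

Local Open Scope classical_set_scope.

(** * Categories and functors *)

Record category := Category {
  Obj :> Type;
  Hom : Obj -> Obj -> Type;
  idm : forall X, Hom X X;
  comp : forall X Y Z, Hom Y Z -> Hom X Y -> Hom X Z;
  comp_idl : forall X Y (f : Hom X Y), comp (idm Y) f = f;
  comp_idr : forall X Y (f : Hom X Y), comp f (idm X) = f;
  compA : forall W X Y Z (h : Hom Y Z) (g : Hom X Y) (f : Hom W X),
    comp h (comp g f) = comp (comp h g) f }.

Record functor (C D : category) := Functor {
  fobj :> C -> D;
  fmap : forall X Y : C, Hom X Y -> Hom (fobj X) (fobj Y);
  fmap_id : forall X : C, fmap (idm X) = idm (fobj X);
  fmap_comp : forall (X Y Z : C) (g : Hom Y Z) (f : Hom X Y),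
    fmap (comp g f) = comp (fmap g) (fmap f) }.

Lemma functor_comp_id (B C D : category) (G : functor C D) (F : functor B C)
  (X : B) : fmap G (fmap F (idm X)) = idm (G (F X)).
Proof. by rewrite !fmap_id. Qed.

Lemma functor_comp_comp (B C D : category) (G : functor C D) (F : functor B C)
  (X Y Z : B) (g : Hom Y Z) (f : Hom X Y) :
  fmap G (fmap F (comp g f)) = comp (fmap G (fmap F g)) (fmap G (fmap F f)).
Proof. by rewrite !fmap_comp. Qed.

Definition functor_comp (B C D : category) (G : functor C D) (F : functor B C) :
  functor B D :=
  @Functor B D (fun X => G (F X)) (fun X Y f => fmap G (fmap F f))
    (functor_comp_id G F) (@functor_comp_comp B C D G F).

Definition faithful (C D : category) (F : functor C D) :=
  forall X Y : C, injective (@fmap C D F X Y).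

Definition full (C D : category) (F : functor C D) :=
  forall (X Y : C) (g : Hom (F X) (F Y)), exists f : Hom X Y, fmap F f = g.

Definition embedding (C D : category) (F : functor C D) :=
  faithful F /\ injective (fobj F).

Definition concrete (C D B : category) (U : functor C B) (V : functor D B)
  (F : functor C D) := functor_comp V F = U.

(** * Topological spaces and continuous maps *)

Definition top_id (X : topologicalType) : continuousType X X :=
  @idfun X : continuousType X X.

Definition top_comp (X Y Z : topologicalType) (g : continuousType Y Z)
  (f : continuousType X Y) : continuousType X Z := g \o f : continuousType X Z.

Lemma top_comp_idl (X Y : topologicalType) (f : continuousType X Y) :
  top_comp (top_id Y) f = f.
Proof. exact/continuousEP. Qed.

Lemma top_comp_idr (X Y : topologicalType) (f : continuousType X Y) :
  top_comp f (top_id X) = f.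
Proof. exact/continuousEP. Qed.

Lemma top_compA (W X Y Z : topologicalType) (h : continuousType Y Z)
  (g : continuousType X Y) (f : continuousType W X) :
  top_comp h (top_comp g f) = top_comp (top_comp h g) f.
Proof. exact/continuousEP. Qed.

Definition top_cat : category :=
  @Category topologicalType (fun X Y => continuousType X Y) top_id top_comp
    top_comp_idl top_comp_idr top_compA.

(** * Preordered spaces *)

(* Preorders are [Prop]-valued relations rather than [porderType] structures:
   the latter carry a display and a strict order, which would count in the
   equality of objects. *)
Record preordered_space := PreorderedSpace {
  ps_space :> topologicalType;
  ps_le : relation ps_space;
  ps_preorder : preorder ps_space ps_le }.

Definition bounded_interval (X : preordered_space) (x y : X) : set X :=
  [set z | ps_le x z /\ ps_le z y].

Definition order_convex (X : preordered_space) (C : set X) :=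
  forall x y z : X, C x -> C z -> ps_le x y -> ps_le y z -> C y.

Definition locally_convex (X : preordered_space) :=
  exists2 B : set (set X), basis B & B `<=` @order_convex X.

Definition bounded_intervals_closed (X : preordered_space) :=
  forall x y : X, closed (bounded_interval x y).

Definition bounded_intervals_connected (X : preordered_space) :=
  forall x y : X, connected (bounded_interval x y).

Record monotone_map (X Y : preordered_space) := MonotoneMap {
  mono_map :> continuousType X Y;
  mono_le : forall x y : X, ps_le x y -> ps_le (mono_map x) (mono_map y) }.

Lemma monotone_map_ext (X Y : preordered_space) (f g : monotone_map X Y) :
  mono_map f = mono_map g -> f = g.
Proof.
case: f g => [f pf] [g pg] /= efg; subst g.
by rewrite (Prop_irrelevance pf pg).
Qed.

Definition mono_id (X : preordered_space) : monotone_map X X :=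
  @MonotoneMap X X (top_id X) (fun x y xy => xy).

Definition mono_comp (X Y Z : preordered_space) (g : monotone_map Y Z)
  (f : monotone_map X Y) : monotone_map X Z :=
  @MonotoneMap X Z (top_comp g f) (fun x y xy => mono_le g (mono_le f xy)).

Lemma mono_comp_idl (X Y : preordered_space) (f : monotone_map X Y) :
  mono_comp (mono_id Y) f = f.
Proof. exact/monotone_map_ext/top_comp_idl. Qed.

Lemma mono_comp_idr (X Y : preordered_space) (f : monotone_map X Y) :
  mono_comp f (mono_id X) = f.
Proof. exact/monotone_map_ext/top_comp_idr. Qed.

Lemma mono_compA (W X Y Z : preordered_space) (h : monotone_map Y Z)
  (g : monotone_map X Y) (f : monotone_map W X) :
  mono_comp h (mono_comp g f) = mono_comp (mono_comp h g) f.
Proof. exact/monotone_map_ext/top_compA. Qed.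

(** * The category K *)

Record kspace := KSpace {
  k_ps :> preordered_space;
  k_antisym : Relation_Definitions.antisymmetric k_ps (@ps_le k_ps);
  k_compact : compact [set: k_ps];
  k_hausdorff : hausdorff_space k_ps;
  k_locally_convex : locally_convex k_ps;
  k_closed : bounded_intervals_closed k_ps;
  k_connected : bounded_intervals_connected k_ps }.

Definition k_cat : category :=
  @Category kspace (fun X Y => monotone_map X Y) (fun X => mono_id X)
    (fun X Y Z g f => mono_comp g f)
    (fun X Y f => mono_comp_idl f) (fun X Y f => mono_comp_idr f)
    (fun W X Y Z h g f => mono_compA h g f).

Definition k_forget : functor k_cat top_cat :=
  @Functor k_cat top_cat (fun X : kspace => ps_space X)
    (fun (X Y : kspace) (f : monotone_map X Y) => mono_map f)
    (fun=> erefl) (fun _ _ _ _ _ => erefl).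

(** * Streams *)

Record opens (X : topologicalType) := Opens {
  open_set :> set X;
  open_setP : open open_set }.

Lemma opens_ext (X : topologicalType) (U V : opens X) :
  open_set U = open_set V -> U = V.
Proof.
case: U V => [U oU] [V oV] /= eUV; subst V.
by rewrite (Prop_irrelevance oU oV).
Qed.

Definition opensT (X : topologicalType) : opens X := Opens (@openT X).

Definition opens_bigcup (X : topologicalType) (O : set (opens X)) : opens X :=
  Opens (bigcup_open (fun U (_ : O U) => open_setP U)).

Definition opens_preimage (X Y : topologicalType) (f : continuousType X Y)
  (U : opens Y) : opens X :=
  Opens (proj1 (continuousP f) (@cts_fun _ _ f) _ (open_setP U)).

(* A preorder on the subset [A] of [T] is identified with its graph, a subset
   of [A * A]; in particular it is determined as a relation on [T]. *)
Definition preorder_on (T : Type) (A : set T) (R : relation T) :=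
  [/\ forall x y, R x y -> A x /\ A y,
      forall x, A x -> R x x &
      Relation_Definitions.transitive T R].

(* [clos_refl_trans] is reflexive on all of [T]; hence the restriction to the
   union of the [A i]. *)
Definition preorder_join (T I : Type) (D : set I) (A : I -> set T)
  (le : I -> relation T) : relation T :=
  fun x y => [/\ (\bigcup_(i in D) A i) x, (\bigcup_(i in D) A i) y &
    clos_refl_trans T (fun u v => exists2 i, D i & le i u v) x y].

Record stream := Stream {
  st_space :> topologicalType;
  st_le : opens st_space -> relation st_space;
  st_preorder : forall U : opens st_space, preorder_on U (st_le U);
  st_join : forall O : set (opens st_space),
    st_le (opens_bigcup O) = preorder_join O (@open_set st_space) st_le }.

Lemma underlying_preorder (S : stream) : preorder S (st_le (opensT S)).
Proof. by case: (st_preorder (opensT S)) => _ r t; split=> // x; apply: r. Qed.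

Definition underlying (S : stream) : preordered_space :=
  PreorderedSpace (underlying_preorder S).

Record stream_map (X Y : stream) := StreamMap {
  smap :> continuousType X Y;
  smap_le : forall (U : opens Y) (x y : X),
    st_le (opens_preimage smap U) x y -> st_le U (smap x) (smap y) }.

Lemma stream_map_ext (X Y : stream) (f g : stream_map X Y) :
  smap f = smap g -> f = g.
Proof.
case: f g => [f pf] [g pg] /= efg; subst g.
by rewrite (Prop_irrelevance pf pg).
Qed.

Lemma stream_id_le (X : stream) (U : opens X) (x y : X) :
  st_le (opens_preimage (top_id X) U) x y ->
  st_le U (top_id X x) (top_id X y).
Proof. by rewrite (_ : opens_preimage _ _ = U) //; exact: opens_ext. Qed.

Definition stream_id (X : stream) : stream_map X X :=
  StreamMap (@stream_id_le X).

Lemma stream_comp_le (X Y Z : stream) (g : stream_map Y Z) (f : stream_map X Y)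
  (U : opens Z) (x y : X) :
  st_le (opens_preimage (top_comp g f) U) x y ->
  st_le U (top_comp g f x) (top_comp g f y).
Proof.
rewrite (_ : opens_preimage _ _ = opens_preimage f (opens_preimage g U)).
  by move=> xy; exact/(smap_le (s := g))/smap_le.
exact: opens_ext.
Qed.

Definition stream_comp (X Y Z : stream) (g : stream_map Y Z)
  (f : stream_map X Y) : stream_map X Z := StreamMap (@stream_comp_le X Y Z g f).

Lemma stream_comp_idl (X Y : stream) (f : stream_map X Y) :
  stream_comp (stream_id Y) f = f.
Proof. exact/stream_map_ext/top_comp_idl. Qed.

Lemma stream_comp_idr (X Y : stream) (f : stream_map X Y) :
  stream_comp f (stream_id X) = f.
Proof. exact/stream_map_ext/top_comp_idr. Qed.

Lemma stream_compA (W X Y Z : stream) (h : stream_map Y Z)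
  (g : stream_map X Y) (f : stream_map W X) :
  stream_comp h (stream_comp g f) = stream_comp (stream_comp h g) f.
Proof. exact/stream_map_ext/top_compA. Qed.

Definition stream_cat : category :=
  @Category stream stream_map stream_id stream_comp
    stream_comp_idl stream_comp_idr stream_compA.

Definition stream_forget : functor stream_cat top_cat :=
  @Functor stream_cat top_cat st_space smap
    (fun=> erefl) (fun _ _ _ _ _ => erefl).

(* Main.v *)
Require Import Defs.
From Stdlib Require Import Relation_Definitions Relation_Operators.
From mathcomp Require Import all_boot.
From mathcomp Require Import boolp classical_sets topology.

Set Implicit Arguments.
Unset Strict Implicit.
Unset Printing Implicit Defensive.

Local Open Scope classical_set_scope.

(** Call a pair u <= v a small step in U when the whole interval [u, v] lies
in U, and let interval_order U be the preorder on U generated by the small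
steps in U. Over all of X this is the given preorder. The theorem says that
interval_order is the only candidate for a stream underlain by X and that, for a
locally convex compact Hausdorff X with closed bounded intervals, it succeeds
exactly when these intervals are connected.

Uniqueness (st_le_interval_order). In a stream, local preorders grow with the
open set. If U is open and [x, y] is a closed interval inside U, then U and the
complement of [x, y] cover the space, so x <= y is witnessed by a chain of local
steps; the chain stays in [x, y], so no step takes place in the complement, and
all of them take place in U. Thus every small step in U belongs to the stream's
preorder on U. Conversely U is covered by convex open sets C, and a step of the
stream's preorder on C is a small step because C is convex.

Existence (interval_cover_chain). For X in K the cosheaf condition amounts to
this: if [x, y] is covered by open sets, then y can be reached from x through
steps each of which is small in one member of the cover. Consider the points
of [x, y] reachable in this way. By compactness a nonempty totally ordered
set of them has an upper bound to which it clusters, and a convex neighbourhood of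
this bound shows that the bound is reachable. By Zorn's lemma there is a maximal
reachable m. If m were not y, connectedness of [m, y] would yield a point of
[m, y] above m in a small convex neighbourhood of m, again reachable.

Fullness. A stream map is monotone on the global preorders. For a monotone map f
and an open U, cover U by convex open sets C: the preorder on the preimage of U
is generated by those on the preimages of the C, and f carries each step there
into a comparable pair of points of C, which is a small step in U.

Image. For a stream with closed intervals, a clopen splitting of [x, y] into B
and its complement gives an open cover of the space none of whose local steps
inside [x, y] crosses the splitting. Chains from x stay on one side, so [x, y]
is connected (closed_intervals_connected). Antisymmetry comes from local
convexity and Hausdorffness, and the stream is then the interval stream of its
underlying space by uniqueness. *)

(** * Reflexive transitive closures *)

Lemma clos_rt_least (T : Type) (R le : relation T) (x y : T) :
  preorder T le -> (forall u v, R u v -> le u v) ->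
  clos_refl_trans T R x y -> le x y.
Proof.
move=> [ler letr] Rle; elim=> [u v /Rle//|//|u v w _ uv _ vw].
exact: letr uv vw.
Qed.

Lemma clos_rt_sub (T : Type) (R R' : relation T) (x y : T) :
  (forall u v, R u v -> R' u v) ->
  clos_refl_trans T R x y -> clos_refl_trans T R' x y.
Proof.
move=> RR'; apply: clos_rt_least; last by move=> u v /RR'; exact: rt_step.
by split=> [u|u v w]; [exact: rt_refl|exact: rt_trans].
Qed.

(** A chain of increasing steps from x to y never leaves the interval [x, y].
This is what makes the covering arguments for streams local to an interval. *)
Lemma clos_rt_between (T : Type) (R le : relation T) (x y : T) :
  preorder T le -> (forall u v, R u v -> le u v) ->
  clos_refl_trans T R x y ->
  clos_refl_trans T (fun u v => [/\ R u v, le x u & le v y]) x y.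
Proof.
move=> leP Rle; have [ler letr] := leP.
elim=> [u v uv|u|u v w Ruv IHuv Rvw IHvw]; first by apply: rt_step; split.
  exact: rt_refl.
have uv := clos_rt_least leP Rle Ruv; have vw := clos_rt_least leP Rle Rvw.
apply: (rt_trans _ _ _ v).
  by apply: clos_rt_sub IHuv => a b [Rab ua bv]; split=> //; exact: letr bv vw.
by apply: clos_rt_sub IHvw => a b [Rab va bw]; split=> //; exact: letr uv va.
Qed.

(** * Equality of bundled structures *)

Lemma preordered_space_ext (T : topologicalType) (le le' : relation T)
    (p : preorder T le) (p' : preorder T le') :
  le = le' -> PreorderedSpace p = PreorderedSpace p'.
Proof. by move=> e; subst le'; rewrite (Prop_irrelevance p p'). Qed.

Lemma kspace_ext (X Y : kspace) : k_ps X = k_ps Y -> X = Y.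
Proof.
case: X Y => X a b c d e f [Y a' b' c' d' e' f'] /= eXY; subst Y.
by congr KSpace; exact: Prop_irrelevance.
Qed.

Lemma stream_ext (T : topologicalType) (le le' : opens T -> relation T) p p'
    j j' : le = le' -> @Stream T le p j = @Stream T le' p' j'.
Proof.
by move=> e; subst le'; congr Stream; exact: Prop_irrelevance.
Qed.

Lemma functor_ext (C D : category) (o : C -> D)
    (m : forall X Y : C, Hom X Y -> Hom (o X) (o Y)) i i' c c' :
  @Functor C D o m i c = @Functor C D o m i' c'.
Proof. by congr Functor; exact: Prop_irrelevance. Qed.

(** * The preorders generated by small intervals *)

Section PreorderedSpace.
Variable X : preordered_space.

Lemma ps_refl (x : X) : ps_le x x.
Proof. by case: (ps_preorder X) => r _; exact: r. Qed.

Lemma ps_trans (y x z : X) : ps_le x y -> ps_le y z -> ps_le x z.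
Proof. by case: (ps_preorder X) => _ t; exact: t. Qed.

Lemma convex_nbhd (U : set X) (x : X) :
  locally_convex X -> open U -> U x ->
  exists C : opens X, [/\ open_set C x, C `<=` U & order_convex C].
Proof.
move=> [B [Bo Bx] Bc] oU Ux.
have /(Bx x)[C [BC Cx] CU] : nbhs x U by exact: open_nbhs_nbhs.
by exists (Opens (Bo _ BC)); split=> //; exact: Bc.
Qed.

Definition interval_step (U : set X) : relation X :=
  fun u v => ps_le u v /\ bounded_interval u v `<=` U.

Definition interval_order (U : set X) : relation X :=
  fun x y => [/\ U x, U y & clos_refl_trans X (interval_step U) x y].

Lemma interval_step_mem (U : set X) (u v : X) :
  interval_step U u v -> U u /\ U v.
Proof. by move=> [uv]; split; apply: b; split=> //; exact: ps_refl. Qed.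

Lemma interval_stepS (U V : set X) (u v : X) :
  U `<=` V -> interval_step U u v -> interval_step V u v.
Proof. by move=> UV [uv uvU]; split=> //; exact: subset_trans UV. Qed.

Lemma order_convex_step (C : set X) (u v : X) :
  order_convex C -> C u -> C v -> ps_le u v -> interval_step C u v.
Proof. by move=> Cc Cu Cv uv; split=> // z [uz zv]; exact: (Cc u z v). Qed.

Lemma interval_order_preorder (U : set X) : preorder_on U (interval_order U).
Proof.
split=> [x y []//|x Ux|x y z [Ux _ xy] [_ Uz yz]]; split=> //.
  exact: rt_refl.
exact: rt_trans xy yz.
Qed.

Lemma interval_order_le (U : set X) (x y : X) :
  interval_order U x y -> ps_le x y.
Proof.
by move=> [_ _]; apply: clos_rt_least (ps_preorder X) _ => u v [].
Qed.

Lemma interval_orderT : interval_order setT = @ps_le X.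
Proof.
apply/funext => x; apply/funext => y; apply/propext.
by split=> [/interval_order_le//|xy]; split=> //; apply: rt_step.
Qed.

(** If x <= y <= x, every convex neighbourhood of x contains y, so x and y
cannot be separated. *)
Lemma locally_convex_antisym :
  hausdorff_space X -> locally_convex X ->
  Relation_Definitions.antisymmetric X (@ps_le X).
Proof.
move=> hX lcX x y xy yx; apply: hX => A B.
rewrite {1}nbhsE => -[V [oV Vx] VA] nB.
have [C [Cx CV Cc]] := convex_nbhd lcX oV Vx.
exists y; split; last exact: nbhs_singleton.
by apply/VA/CV/(Cc x y x).
Qed.

End PreorderedSpace.

(** * The interval stream of an object of K *)

Section KSpace.
Variable X : kspace.

(** The final segments of a chain A form a filter base; compactness gives it a
cluster point p. For a in A the final segment above a lies in the closed
interval [a, y], hence so does p: a cluster point is an upper bound. *)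
Lemma chain_bound_closure (x y : X) (A : set X) :
  A !=set0 -> total_on A (@ps_le X) -> A `<=` bounded_interval x y ->
  exists p, [/\ bounded_interval x y p, forall a, A a -> ps_le a p
    & closure A p].
Proof.
move=> A0 Atot Axy.
pose tail a := [set b | A b /\ ps_le a b].
have PF : ProperFilter (filter_from A tail).
  apply: filter_from_proper => [|a Aa]; last first.
    by exists a; split=> //; exact: ps_refl.
  apply: filter_from_filter => // a b Aa Ab.
  have [ab|ba] := Atot _ _ Aa Ab.
    by exists b => // z [Az bz]; split; split=> //; exact: ps_trans bz.
  by exists a => // z [Az az]; split; split=> //; exact: ps_trans az.
have [p [_ pcl]] := k_compact PF filterT.
have clp (B : set X) a : A a -> tail a `<=` B -> closed B -> B p.
  move=> Aa aB; apply => N Np.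
  by apply: (pcl B N) => //; exists a.
have [a0 Aa0] := A0.
exists p; split.
- by apply: (clp _ a0) => // [z [/Axy]//|]; exact: k_closed.
- move=> a Aa; suff [] : bounded_interval a y p by [].
  apply: (clp _ a) => // [z [/Axy[_ zy] az]//|]; exact: k_closed.
- by move=> N Np; apply: (pcl A N) => //; exists a0 => // z [].
Qed.

(** By antisymmetry {m} is the interval [m, m], hence closed; if m were isolated
in [m, y], then {m} would be clopen in this connected set. *)
Lemma interval_bottom_not_isolated (m y : X) (C : set X) :
  open C -> C m -> ps_le m y -> m <> y ->
  exists w, [/\ C w, bounded_interval m y w & w <> m].
Proof.
move=> oC Cm my mney; apply: contrapT => /forallNP nw.
have mE : bounded_interval m m = [set m].
  apply/seteqP; split=> [z [mz zm]|z ->]; first exact: k_antisym.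
  by split; exact: ps_refl.
have Imm : bounded_interval m y m by split=> //; exact: ps_refl.
have Iyy : bounded_interval m y y by split=> //; exact: ps_refl.
suff E : [set m] = bounded_interval m y by apply: mney; move: Iyy; rewrite -E.
apply: (@k_connected X); first by exists m.
- exists C => //; apply/seteqP; split=> [z ->//|z [Iz Cz] /=].
  by apply: contrapT => zm; exact: (nw z).
- exists (bounded_interval m m); first exact: k_closed.
  by rewrite mE; apply/esym/setIidr => z ->.
Qed.

(** The heart of the existence proof: an interval covered by open sets can be
traversed by finitely many steps, each with its interval inside one member of
the cover. Only finitely many steps are allowed, yet passing to a limit costs a
single step, since a point of the chain is already in a convex neighbourhood of
the limit. This makes Zorn's lemma applicable to the reachable points. *)
Lemma interval_cover_chain (O : set (opens X)) (x y : X) :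
  ps_le x y -> bounded_interval x y `<=` \bigcup_(U in O) U ->
  clos_refl_trans X (fun u v => exists2 U, O U & interval_step U u v) x y.
Proof.
move=> xy xyO; set step := (fun u v : X => _).
have local (z : X) : bounded_interval x y z -> exists C : opens X,
    [/\ open_set C z, order_convex C &
      forall u v, open_set C u -> open_set C v -> ps_le u v -> step u v].
  move=> /xyO[U OU Uz].
  have [C [Cz CU Cc]] := convex_nbhd (k_locally_convex X) (open_setP U) Uz.
  exists C; split=> // u v Cu Cv uv.
  by exists U => //; apply: interval_stepS CU _; exact: order_convex_step.
pose reach (z : X) := clos_refl_trans X step x z /\ ps_le z y.
have reachI z : reach z -> bounded_interval x y z.
  move=> [xz zy]; split=> //.
  by apply: clos_rt_least xz; [exact: ps_preorder|move=> u v [U _ []]].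
have reachx : reach x by split=> //; exact: rt_refl.
pose le (s t : {z | reach z}) := `[< ps_le (sval s) (sval t) >].
have [|||A Atot|[m rm] mmax] := @Zorn _ le.
- by move=> s; apply/asboolP; exact: ps_refl.
- by move=> r s t /asboolP rs /asboolP st; apply/asboolP; exact: ps_trans st.
- move=> [s rs] [t rt] /asboolP/= st /asboolP/= ts; apply: eq_exist.
  exact: k_antisym.
  (* Every point of [x, y] has a neighbourhood in which all comparable pairs
     are steps; the bound of a chain is reached from a point of the chain in
     such a neighbourhood. The empty chain is bounded by x. *)
- have [A0|/set0P/negP] := pselect (A !=set0); last first.
    move=> /negPn/eqP->; by exists (exist _ x reachx).
  have [|||p [Ip Ap clp]] := @chain_bound_closure x y (sval @` A).
  + by have [s As] := A0; exists (sval s); exists s.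
  + move=> _ _ [s As <-] [t At <-].
    by have [/asboolP|/asboolP] := Atot _ _ As At; [left|right].
  + by move=> _ [s _ <-]; apply: reachI; exact: (svalP s).
  have [C [Cp _ Cstep]] := local p Ip.
  have [_ [[s As <-] Cs]] := clp C (open_nbhs_nbhs (conj (open_setP C) Cp)).
  have rp : reach p.
    split; last by case: Ip.
    have [xs _] := svalP s; apply: rt_trans xs _; apply: rt_step.
    by apply: Cstep => //; apply: Ap; exists s.
  by exists (exist _ p rp) => t At; apply/asboolP/Ap; exists t.
  (* A maximal reachable point other than y could be moved up within [m, y]. *)
- have [xm my] := rm.
  have [<-//|mney] := pselect (m = y).
  have [C [Cm _ Cstep]] := local m (reachI _ rm).
  have [w [Cw [mw wy] wm]] :=
    interval_bottom_not_isolated (open_setP C) Cm my mney.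
  have rw : reach w.
    by split=> //; apply: rt_trans xm _; apply: rt_step; exact: Cstep.
  have /(congr1 sval)/= := mmax (exist _ w rw) (asboolT mw).
  by move/wm.
Qed.

Lemma interval_order_join (O : set (opens X)) :
  interval_order (opens_bigcup O) =
  preorder_join O (@open_set X) (fun U : opens X => interval_order U).
Proof.
apply/funext => x; apply/funext => y; apply/propext.
split=> -[Ox Oy xy]; split=> //.
- have stp : preorder X (clos_refl_trans X
    (fun u v => exists2 U : opens X, O U & interval_order U u v)).
    by split=> [u|u v w]; [exact: rt_refl|exact: rt_trans].
  apply: clos_rt_least stp _ xy => u v [uv uvO].
  apply: clos_rt_sub (interval_cover_chain uv uvO) => a b [U OU ab].
  have [Ua Ub] := interval_step_mem ab.
  by exists U => //; split=> //; exact: rt_step.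
- apply: (@clos_rt_least _ _ (clos_refl_trans X _)) xy => [|u v [U OU [_ _]]].
    by split=> [u|u v w]; [exact: rt_refl|exact: rt_trans].
  by apply: clos_rt_sub => a b; apply: interval_stepS => z Uz; exists U.
Qed.

Definition interval_stream : stream :=
  @Stream X (fun U => interval_order U)
    (fun U => interval_order_preorder U) interval_order_join.

Lemma underlying_interval_stream : underlying interval_stream = X.
Proof.
have eta (P : preordered_space) : PreorderedSpace (ps_preorder P) = P.
  by case: P.
by rewrite -[RHS]eta; apply: preordered_space_ext; exact: interval_orderT.
Qed.

End KSpace.

(** * Streams with closed intervals *)

Section Stream.
Variable S : stream.
Implicit Types (U V : opens S) (O : set (opens S)) (x y : S).

Lemma st_le_mem U x y : st_le U x y -> open_set U x /\ open_set U y.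
Proof. by case: (st_preorder U) => m _ _; exact: m. Qed.

Lemma st_le_joinE U O : \bigcup_(V in O) V = U ->
  st_le U = preorder_join O (@open_set S) (@st_le S).
Proof. by move=> e; rewrite -st_join; congr st_le; exact/opens_ext/esym. Qed.

Lemma st_leS U V x y : U `<=` V -> st_le U x y -> st_le V x y.
Proof.
move=> UV xy; have [Ux Uy] := st_le_mem xy.
rewrite (@st_le_joinE V [set U; V]); last first.
  by rewrite bigcup_setU1 bigcup_set1 setUidr.
split; [by exists U => //; left|by exists U => //; left|].
by apply: rt_step; exists U => //; left.
Qed.

Lemma st_le_clos_rt U (R : relation S) x y :
  (forall u v, R u v -> st_le U u v) -> open_set U x ->
  clos_refl_trans S R x y -> st_le U x y.
Proof.
have [_ r t] := st_preorder U => RU Ux xy.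
suff [<-|//] : x = y \/ st_le U x y by exact: r.
apply: (@clos_rt_least _ R (fun u v => u = v \/ st_le U u v)) xy.
  split=> [u|u v w]; first by left.
  by move=> [->//|uv] [<-|vw]; right=> //; exact: t uv vw.
by move=> u v /RU; right.
Qed.

(** The form in which the circulation axiom is applied to covers of the whole
space: the steps of a chain from x to y have both ends in [x, y]. *)
Lemma cover_chain_between O x y :
  \bigcup_(V in O) V = setT -> st_le (opensT S) x y ->
  let I := @bounded_interval (underlying S) x y in
  clos_refl_trans S
    (fun u v => [/\ exists2 V, O V & st_le V u v, I u & I v]) x y.
Proof.
move=> OT xy I; have leP := underlying_preorder S.
have step_le u v : (exists2 V, O V & st_le V u v) -> st_le (opensT S) u v.
  by move=> [V _]; exact: st_leS.
move: xy; rewrite {1}(@st_le_joinE (opensT S) _ OT) => -[_ _].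
move=> /(clos_rt_between leP step_le).
have [_ letr] := leP.
apply: clos_rt_sub => u v [uv xu vy]; have uW := step_le _ _ uv.
by split=> //; split=> //; [exact: letr uW vy|exact: letr xu uW].
Qed.

(** The space is covered by U and the complement of the closed interval [x, y].
A chain from x to y stays in [x, y], so all its steps take place in U. *)
Lemma closed_interval_step U x y :
  closed (@bounded_interval (underlying S) x y) ->
  @interval_step (underlying S) U x y -> st_le U x y.
Proof.
move=> Icl [xy IU].
pose W := Opens (closed_openC Icl).
have UWT : \bigcup_(V in [set U; W]) V = setT.
  rewrite bigcup_setU1 bigcup_set1; apply/seteqP; split=> // z _ /=.
  have [/IU|] := pselect (@bounded_interval (underlying S) x y z).
    by left.
  by right.
have Ux : open_set U x.
  by apply: IU; split=> //; exact: (ps_refl (X := underlying S)).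
apply: st_le_clos_rt (cover_chain_between UWT xy) => // u v.
by move=> [[V [->|->] uv] Iu Iv]; last case/st_le_mem: uv => /(_ Iu).
Qed.

(** The underlying preordered space determines the stream: small steps in U are
forced by [closed_interval_step], and the steps in convex open sets, which
generate the preorder on U, are small. *)
Lemma st_le_interval_order U x y :
  locally_convex (underlying S) ->
  bounded_intervals_closed (underlying S) ->
  st_le U x y <-> @interval_order (underlying S) U x y.
Proof.
move=> lcS clS; split=> [xy|[Ux Uy xy]].
  have [Ux Uy] := st_le_mem xy; split=> //; move: xy.
  pose O := [set C : opens S | C `<=` U /\ @order_convex (underlying S) C].
  rewrite (@st_le_joinE U O); last first.
    apply/seteqP; split=> [z [C [CU _] /CU//]|z Uz].
    have [C [Cz CU Cc]] := convex_nbhd lcS (open_setP U) Uz.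
    by exists C.
  move=> [_ _]; apply: clos_rt_sub => u v [C [CU Cc] uv].
  have [Cu Cv] := st_le_mem uv.
  apply: (@interval_stepS (underlying S)) CU _; apply: order_convex_step => //.
  exact: st_leS uv.
by apply: st_le_clos_rt xy => // u v; exact: closed_interval_step.
Qed.

(** Let B = I `&` C = I `&` D be clopen in the interval I, with C open and D
closed. The open sets P = ~` I `|` C and Q = ~` (I `&` D) cover the space; a
point of I is in P iff it is in B, and in Q iff it is not. So local steps inside
I preserve membership in B, and B holds throughout I once it holds anywhere. *)
Lemma closed_intervals_connected :
  bounded_intervals_closed (underlying S) ->
  bounded_intervals_connected (underlying S).
Proof.
move=> clS x y B [b Bb] [C oC BC] [D clD BD].
set I := bounded_interval x y in BC BD *.
pose P := Opens (openU (closed_openC (clS x y)) oC).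
pose Q := Opens (closed_openC (closedI (clS x y) clD)).
have PQT : \bigcup_(V in [set P; Q]) V = setT.
  rewrite bigcup_setU1 bigcup_set1; apply/seteqP; split=> // z _ /=.
  have [Bz|nBz] := pselect (B z).
    by left; right; move: Bz; rewrite BC => -[].
  by right; change (~ (I `&` D) z); rewrite -BD.
have Bx z : I z -> B x <-> B z.
  move=> [xz zy].
  apply: (@clos_rt_least S _ (fun u v => B u <-> B v))
    (cover_chain_between PQT xz).
    by split=> [//|u v w uv vw]; rewrite uv.
  have sub w : bounded_interval x z w -> I w.
    by move=> [xw wz]; split=> //; exact: ps_trans wz zy.
  move=> u v [[V [->|->] /st_le_mem[Vu Vv]] /sub Iu /sub Iv].
    have BP w : I w -> open_set P w -> B w by move=> Iw [//|Cw]; rewrite BC.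
    by split=> _; exact: BP.
  have BQ w : open_set Q w -> ~ B w by move=> /= nw; rewrite BD.
  by split=> [/(BQ _ Vu)|/(BQ _ Vv)].
apply/seteqP; split=> [z|z Iz]; first by rewrite BC => -[].
apply/(Bx z Iz)/(Bx b _) => //.
by move: Bb; rewrite BC => -[].
Qed.

End Stream.

(** * The embedding *)

Lemma interval_stream_unique (X : kspace) (S : stream) :
  underlying S = X -> interval_stream X = S.
Proof.
move: X => [P anti cpt haus lc cl con] /= e; subst P.
case: S anti cpt haus lc cl con => T le p j anti cpt haus lc cl con.
apply: stream_ext; apply/funext => U; apply/funext => x; apply/funext => y.
by apply/propext; split=> /(@st_le_interval_order (Stream p j)); exact.
Qed.

(** The image of an interval inside the preimage of U need not lie in an
interval inside U. Covering U by convex open sets first repairs this: a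
comparable pair in a convex set spans an interval inside it. *)
Lemma monotone_interval_order (X Y : kspace) (f : monotone_map X Y)
    (U : opens Y) (x y : X) :
  interval_order (opens_preimage (mono_map f) U) x y ->
  interval_order U (f x) (f y).
Proof.
pose O := [set V : opens X | exists C : opens Y,
  [/\ V = opens_preimage (mono_map f) C, C `<=` U & order_convex C]].
have -> : opens_preimage (mono_map f) U = opens_bigcup O.
  apply/opens_ext/seteqP; split=> [z Uz|z [_ [C [-> CU _]] /CU//]].
  have [C [Cz CU Cc]] := convex_nbhd (k_locally_convex Y) (open_setP U) Uz.
  by exists (opens_preimage (mono_map f) C) => //; exists C.
rewrite interval_order_join => -[].
move=> [V [C [-> CU _]] Cx] [V' [C' [-> CU' _]] Cy] xy.
split; [exact: CU|exact: CU'|].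
apply: (@clos_rt_least X _ (fun u v => clos_refl_trans Y _ (f u) (f v))) xy.
  by split=> [u|u v w]; [exact: rt_refl|exact: rt_trans].
move=> u v [_ [D [-> DU Dc]] uv].
have [Du Dv _] := uv.
apply: rt_step; apply: interval_stepS DU _; apply: order_convex_step => //.
exact/(mono_le f)/(interval_order_le uv).
Qed.

Definition interval_stream_map (X Y : kspace) (f : monotone_map X Y) :
    stream_map (interval_stream X) (interval_stream Y) :=
  @StreamMap (interval_stream X) (interval_stream Y) (mono_map f)
    (fun U x y => @monotone_interval_order X Y f U x y).

Lemma interval_stream_map_id (X : kspace) :
  interval_stream_map (mono_id X) = stream_id (interval_stream X).
Proof. exact: stream_map_ext. Qed.

Lemma interval_stream_map_comp (X Y Z : kspace) (g : monotone_map Y Z)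
    (f : monotone_map X Y) :
  interval_stream_map (mono_comp g f) =
  stream_comp (interval_stream_map g) (interval_stream_map f).
Proof. exact: stream_map_ext. Qed.

Definition interval_functor : functor k_cat stream_cat :=
  @Functor k_cat stream_cat interval_stream interval_stream_map
    interval_stream_map_id interval_stream_map_comp.

Lemma stream_map_monotone (X Y : kspace)
    (g : stream_map (interval_stream X) (interval_stream Y)) (x y : X) :
  ps_le x y -> ps_le (smap g x : Y) (smap g y).
Proof.
move=> xy; apply: (@interval_order_le Y setT).
apply: (@smap_le _ _ g (opensT Y)); rewrite /= preimage_setT.
by rewrite interval_orderT.
Qed.

Theorem theorem4p7 :
  exists F : functor k_cat stream_cat,
    [/\ embedding F,
        full F,
        concrete k_forget stream_forget F,
        forall X : kspace,
          unique (fun S : stream => underlying S = k_ps X) (F X) &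
        forall S : stream,
          compact [set: S]%classic ->
          hausdorff_space S ->
          locally_convex (underlying S) ->
          bounded_intervals_closed (underlying S) ->
          exists X : kspace, F X = S].
Proof.
exists interval_functor; split.
- split=> [X Y f g /(congr1 (@smap _ _)) fg|X Y /(congr1 underlying) XY].
    exact: monotone_map_ext.
  by apply: kspace_ext; rewrite -!underlying_interval_stream.
- move=> X Y g; exists (MonotoneMap (@stream_map_monotone X Y g)).
  exact: stream_map_ext.
- exact: functor_ext.
- move=> X; split; first exact: underlying_interval_stream.
  exact: interval_stream_unique.
- move=> S cS hS lcS clS.
  exists (@KSpace (underlying S)
    (@locally_convex_antisym (underlying S) hS lcS) cS hS lcS clS
    (closed_intervals_connected clS)).
  exact: interval_stream_unique.
Qed.
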